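(* Let $q$ be a prime power, $t$ a nonnegative integer, $(\sigma,\tilde\tau)\in\Theta_{t,q}$ and let $\epsilon>0$. Then, for all sufficiently large $n$, there exists a nonempty $(\sigma,\tau)$-transitive set $Y$ in $\mathrm{GL}(n,q)$ satisfying $|Y|/|\mathrm{GL}(n,q)|<\epsilon$, where $\tau=(n-|\sigma|-|\tilde\tau|,\tilde\tau_1,\tilde\tau_2,\dots)$.
   Context: Partitions are nonincreasing sequences $\lambda=(\lambda_1,\lambda_2,\dots)$ of nonnegative integers with finite sum $|\lambda|$; the nonzero entries are the parts. A composition of $n$ is a finite sequence of positive integers with sum $n$. $\Sigma_{n,q}$ is the set of pairs $(\rho,\mathcal I)$ with $\rho=(\rho_1,\dots,\rho_\ell)$ a composition of $n$ and $\mathcal I\subseteq\{1,\dots,\ell\}$, where for $q=2$ it is required that $\rho_i>1$ for all $i\notin\mathcal I$. For $\alpha=(\rho,\mathcal I)$, an $\alpha$-flag is a pair $(F,B)$ where $F=(V_1,\dots,V_\ell)$ is a sequence of subspaces $\{0\}=V_0\le V_1\le\cdots\le V_\ell=\mathbb{F}_q^n$ with $\dim(V_i/V_{i-1})=\rho_i$, and $B$ is a tuple containing one ordered basis of $V_i/V_{i-1}$ for each $i\in\mathcal I$. $\mathrm{GL}(n,q)$ acts naturally on $\alpha$-flags. $\operatorname{type}(\alpha)=(\sigma,\tau)$, where $\sigma$ is the partition with parts $\rho_i$, $i\in\mathcal I$, and $\tau$ the partition with parts $\rho_i$, $i\notin\mathcal I$. $\Theta_{m,q}$ is the set of all pairs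 of partitions $(\sigma,\tau)$ with $|\sigma|+|\tau|=m$ and, if $q=2$, all parts of $\tau$ larger than $1$; for $m=n$ these are exactly the types of elements of $\Sigma_{n,q}$. For $(\sigma,\tau)\in\Theta_{n,q}$, a subset $Y$ of $\mathrm{GL}(n,q)$ is $(\sigma,\tau)$-transitive if for some $\alpha\in\Sigma_{n,q}$ of type $(\sigma,\tau)$ there is a constant $r$ such that for all $\alpha$-flags $a,b$ exactly $r$ elements $g\in Y$ satisfy $ga=b$. *)

(* Defs.v *)
From HB Require Import structures.
From mathcomp Require Import all_boot all_order all_algebra.
From mathcomp Require Import reals.

Set Implicit Arguments.
Unset Strict Implicit.
Unset Printing Implicit Defensive.

Import Order.TTheory GRing.Theory Num.Theory.

Local Open Scope ring_scope.

(* A partition is encoded by the nonincreasing list of its (nonzero) parts. *)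
Definition is_partition (s : seq nat) : bool :=
  sorted geq s && all (fun k => 0 < k)%N s.

Definition in_Theta (m q : nat) (sigma tau : seq nat) : bool :=
  [&& is_partition sigma, is_partition tau, sumn sigma + sumn tau == m
    & (q == 2) ==> all (fun k => 1 < k) tau]%N.

(* A pair (rho, I) with I a set of positions of rho, numbered from 0. *)
Record marked_seq := MarkedSeq {
  rho : seq nat;
  marks : {set 'I_(size rho)}
}.

Definition part (alpha : marked_seq) (i : 'I_(size (rho alpha))) : nat :=
  nth 0%N (rho alpha) i.

Definition in_Sigma (n q : nat) (alpha : marked_seq) : bool :=
  [&& all (fun k => 0 < k) (rho alpha), sumn (rho alpha) == n
    & (q == 2) ==> [forall i, (i \notin marks alpha) ==> (1 < part i)]]%N.

Definition type_of (alpha : marked_seq) : seq nat * seq nat :=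
  (sort geq [seq part i | i in marks alpha],
   sort geq [seq part i | i in ~: marks alpha]).

Section Flags.
Variables (F : finFieldType) (n : nat).
Implicit Types (U W : {vspace 'cV[F]_n}).

(* GL(n, q) as a set of n x n matrices, valid for every n (the type
   {'GL_n[F]} consists of matrices of size n.-1.+1). *)
Definition GL : {set 'M[F]_n} := [set g | g \in unitmx].

Definition vcoset U (v : 'cV[F]_n) : {set 'cV[F]_n} :=
  [set x | x - v \in U].

(* B is an ordered basis of the quotient space W / U, whose vectors are the
   cosets of U in W; v lists representatives, through which linear
   combinations in W / U are computed. *)
Definition quotient_basis W U (B : seq {set 'cV[F]_n}) : Prop :=
  exists v : seq 'cV[F]_n,
    [/\ {subset v <= W},
        B = [seq vcoset U x | x <- v],
        (forall c : 'I_(size v) -> F,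
           \sum_i c i *: v`_i \in U -> forall i, c i = 0)
      & (forall w, w \in W ->
           exists c : 'I_(size v) -> F, w - \sum_i c i *: v`_i \in U)].

(* The pairs (V_0, ..., V_l), (B_i)_(i in I) underlying alpha-flags. *)
Definition preflag (alpha : marked_seq) : Type :=
  ({ffun 'I_(size (rho alpha)).+1 -> {vspace 'cV[F]_n}} *
   {ffun {i : 'I_(size (rho alpha)) | i \in marks alpha} ->
         seq {set 'cV[F]_n}})%type.

(* The position i counted from 0 corresponds to the step from
   V (before i) to V (after i). *)
Definition before l (i : 'I_l) : 'I_l.+1 := widen_ord (leqnSn l) i.
Definition after l (i : 'I_l) : 'I_l.+1 := lift ord0 i.

Definition is_flag (alpha : marked_seq) (a : preflag alpha) : Prop :=
  let: (V, B) := a in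
  [/\ V ord0 = 0%VS,
      V ord_max = fullv,
      (forall i, (V (before i) <= V (after i))%VS),
      (forall i, (\dim (V (after i)) - \dim (V (before i)))%N = part i)
    & (forall i, quotient_basis (V (after (val i))) (V (before (val i)))
                                (B i))].

Definition act_flag (alpha : marked_seq) (g : 'M[F]_n) (a : preflag alpha) :
    preflag alpha :=
  ([ffun i => (linfun (mulmx g) @: a.1 i)%VS],
   [ffun i => [seq [set g *m x | x in C] | C : {set 'cV[F]_n} <- a.2 i]]).

Definition transitive_set (sigma tau : seq nat) (Y : {set 'M[F]_n}) : Prop :=
  exists2 alpha : marked_seq,
    in_Sigma n #|F| alpha /\ type_of alpha = (sigma, tau)
  & exists r : nat, forall a b : preflag alpha, is_flag a -> is_flag b ->
      #|[set g in Y | act_flag g a == b]| = r.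

End Flags.

Arguments GL F n : clear implicits.

(* Main.v *)
(* Fix disjoint index families (p_kj) and (d_kj), k < s, j <= t, in {0..n-1}.
   The matrices h = 1 + N, with N supported on the rows p_kj and vanishing on
   the columns p_kj, form an abelian group H, and N |-> (sum_j N(p_kj, d_kj))_k
   is a homomorphism chi from H to F^s.  It extends to a map c on GL(n, q) with
   c(g h) = c(g) + chi(h) for h in H.  The sum defining the k-th coordinate of
   chi involves t + 1 columns, so chi remains surjective on the pointwise
   stabilizer in H of any subspace of dimension at most t.  Right multiplication
   by these stabilizers shows that c takes each value equally often on
   {g | g a = b} for all flags a, b whose proper part spans dimension at most t.
   As GL(n, q) is transitive on flags, Y = {c = 0} is transitive, and its
   density is q^-s. *)
Require Import Defs.
From HB Require Import structures.
From mathcomp Require Import all_boot all_order all_algebra.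
From mathcomp Require Import reals.
From mathcomp Require Import boolp.
Set Implicit Arguments.
Unset Strict Implicit.
Unset Printing Implicit Defensive.
Import Order.TTheory GRing.Theory Num.Theory.
Local Open Scope ring_scope.

(** * A colouring of GL(n, q) and its translations *)

Section Coloring.
Variables (F : finFieldType) (n s t : nat).
Variable e : ('I_s * 'I_t.+1) + ('I_s * 'I_t.+1) -> 'I_n.
Hypothesis e_inj : injective e.

Let p (k : 'I_s) (j : 'I_t.+1) : 'I_n := e (inl (k, j)).
Let d (k : 'I_s) (j : 'I_t.+1) : 'I_n := e (inr (k, j)).

Let p_eq k j k' j' : (p k j == p k' j') = (k == k') && (j == j').
Proof. by rewrite (inj_eq e_inj). Qed.

Let d_eq k j k' j' : (d k j == d k' j') = (k == k') && (j == j').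
Proof. by rewrite (inj_eq e_inj). Qed.

(** The equations [coord_proj *m N = N] and [N *m coord_proj = 0] encode the row and column
    conditions on [N] that define H. *)
Definition coord_proj : 'M[F]_n :=
  \matrix_(x, y) ((x == y) && [exists u, x == e (inl u)])%:R.

(** The homomorphism chi, as a linear map on all matrices. *)
Definition block_traces (M : 'M[F]_n) : 'rV[F]_s :=
  \row_k \sum_j M (e (inl (k, j))) (e (inr (k, j))).

(* [P *m pinvmx (g *m P)] is a left inverse of [g *m P] on the range of [P]
   that depends only on the columns of [g] selected by [P]. *)
Definition color (g : 'M[F]_n) : 'rV[F]_s :=
  block_traces (coord_proj *m pinvmx (g *m coord_proj) *m g).

Lemma block_tracesD M N :
  block_traces (M + N) = block_traces M + block_traces N.
Proof.
by apply/rowP=> k; rewrite !mxE -big_split; apply: eq_bigr => j _; rewrite mxE.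
Qed.

(** With P the projection, N P = 0 gives g (1 + N) P = g P, so both colours use the same left
    inverse L. Moreover L g N = L g P N = P N = N. *)
Lemma color_mul g N : g \in unitmx ->
    coord_proj *m N = N -> N *m coord_proj = 0 ->
  color (g *m (1%:M + N)) = color g + block_traces N.
Proof.
move=> g_unit PN NP; rewrite /color.
have -> : g *m (1%:M + N) *m coord_proj = g *m coord_proj.
  by rewrite -mulmxA mulmxDl NP addr0 mul1mx.
set L := coord_proj *m pinvmx _.
have LgP : L *m (g *m coord_proj) = coord_proj.
  (* As [g] is invertible, the row space of [coord_proj] lies in that of [g *m coord_proj]. *)
  by apply: mulmxKpV; rewrite -{1}(mulKmx g_unit coord_proj) submxMl.
rewrite mulmxDr mulmx1 mulmxDr block_tracesD; congr (_ + block_traces _).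
by rewrite -{1}PN !mulmxA -(mulmxA L) LgP PN.
Qed.

(** The square of N is N P N = 0, so 1 - N inverts 1 + N. *)
Lemma nilpotent_unit N : coord_proj *m N = N -> N *m coord_proj = 0 ->
  1%:M + N \in unitmx.
Proof.
move=> PN NP; have NN : N *m N = 0 by rewrite -{2}PN mulmxA NP mul0mx.
apply: (@proj1 _ ((1%:M - N) \in unitmx)); apply: mulmx1_unit.
by rewrite mulmxDl mul1mx mulmxBr NN mulmx1 subr0 subrK.
Qed.

Let D (k : 'I_s) : 'M[F]_(t.+1, n) := \matrix_(j, y) (y == d k j)%:R.

(* The covector [psi *m D k] is supported on the block [d k], which has more
   coordinates than the dimension of [U]. *)
Let annihilator (U : {vspace 'cV[F]_n}) (k : 'I_s) : (\dim U <= t)%N ->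
  exists psij : 'rV[F]_t.+1 * 'I_t.+1,
    psij.1 0 psij.2 = 1 /\ (forall u, u \in U -> psij.1 *m D k *m u = 0).
Proof.
move=> dimU; pose B : 'M[F]_(n, \dim U) := \matrix_(x, i) (vbasis U)`_i x 0.
have : kermx (D k *m B) != 0.
  rewrite kermx_eq0 /row_free neq_ltn.
  by rewrite (leq_ltn_trans (rank_leq_col _)).
case/rowV0Pn=> psi /sub_kermxP psiDB psi_n0.
have /existsP [j psij] : [exists j, psi 0 j != 0].
  apply: contraR psi_n0; rewrite negb_exists => /forallP psi0.
  by apply/eqP/rowP=> j; rewrite mxE; apply/eqP; rewrite -[_ == _]negbK psi0.
exists ((psi 0 j)^-1 *: psi, j); split=> [|u uU]; first by rewrite mxE mulVf.
rewrite (coord_vbasis uU) mulmx_sumr big1 // => i _.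
rewrite -scalemxAr -scalemxAl -scalemxAl.
have -> : (vbasis U)`_i = col i B by apply/colP=> x; rewrite !mxE.
by rewrite colE mulmxA -(mulmxA psi) psiDB mul0mx !scaler0.
Qed.

(** For each k, an annihilator of [U] supported on the block [d k], with entry 1 at some index i, is
    scaled by [v 0 k] and put in row [p k i]. The resulting N kills [U] and has block traces [v];
    take h = 1 + N. *)
Lemma color_translation (U : {vspace 'cV[F]_n}) (v : 'rV[F]_s) :
    (\dim U <= t)%N ->
  exists h : 'M[F]_n,
    [/\ h \in unitmx, forall u, u \in U -> h *m u = u
      & forall g, g \in unitmx -> color (g *m h) = color g + v].
Proof.
move=> dimU; have [psij psijP] := fin_all_exists (fun k => annihilator k dimU).
pose c k := (psij k).1; pose i k := (psij k).2.
have c_i k : c k 0 (i k) = 1 by case: (psijP k).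
have cDU k u : u \in U -> c k *m D k *m u = 0 by case: (psijP k) => _; apply.
pose N : 'M[F]_n :=
  \sum_k v 0 k *: (delta_mx (p k (i k)) 0 *m (c k *m D k)).
have P_delta k j : coord_proj *m delta_mx (p k j) 0 = delta_mx (p k j) 0 :> 'cV_n.
  apply/colP=> x; rewrite -colE !mxE eqxx andbT.
  case: eqP => //= ->; case: existsP => // -[]; by exists (k, j).
(* The index families p and d are disjoint, by injectivity of [e]. *)
have D_P k : D k *m coord_proj = 0.
  apply/matrixP=> j y; rewrite !mxE big1 // => x _; rewrite !mxE.
  case: eqP => [->|_]; last by rewrite mul0r.
  by case: existsP => [[u]|]; rewrite ?andbF ?mulr0 // (inj_eq e_inj).
have PN : coord_proj *m N = N.
  rewrite mulmx_sumr; apply: eq_bigr => k _.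
  by rewrite -scalemxAr (mulmxA coord_proj) P_delta.
have NP : N *m coord_proj = 0.
  by rewrite mulmx_suml big1 // => k _; rewrite -scalemxAl -!mulmxA D_P !mulmx0 scaler0.
have NU u : u \in U -> N *m u = 0.
  move=> uU; rewrite mulmx_suml big1 // => k _.
  by rewrite -scalemxAl -mulmxA cDU // mulmx0 scaler0.
have cD k j k' : (c k' *m D k') 0 (d k j) = (k == k')%:R * c k' 0 j.
  rewrite mxE (bigD1 j) //= mxE d_eq eqxx andbT big1 => [|j' /negPf j'_neq].
    by rewrite addr0 mulrC.
  by rewrite mxE d_eq (eq_sym j) j'_neq andbF mulr0.
(* Block k of the columns meets only the k-th summand, whose single row forces [j = i k]. *)
have trN : block_traces N = v.
  apply/rowP=> k; rewrite mxE (bigD1 (i k)) //= [X in _ + X]big1 => [|j j_neq].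
    rewrite addr0 summxE (bigD1 k) //= big1 => [|k' /negPf k'_neq].
      by rewrite addr0 mxE mxE big_ord1 cD !mxE !eqxx c_i !mulr1.
    by rewrite mxE mxE big_ord1 cD eq_sym k'_neq mul0r !mulr0.
  rewrite summxE big1 // => k' _.
  rewrite mxE mxE big_ord1 cD !mxE p_eq andbT.
  by case: eqP => [<-|_]; rewrite ?mul0r ?(negPf j_neq) ?mul0r ?mulr0.
exists (1%:M + N); split=> [|u uU|g g_unit]; first exact: nilpotent_unit.
  by rewrite mulmxDl NU // mul1mx addr0.
by rewrite color_mul // trN.
Qed.

End Coloring.

(** * Transitivity of GL(n, q) on flags *)

Section FlagTransitivity.
Variables (F : finFieldType) (n : nat).
Implicit Types (U W : {vspace 'cV[F]_n}) (g h : 'M[F]_n).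

Lemma act_flag_mul alpha g h (a : preflag F n alpha) :
  act_flag (g *m h) a = act_flag g (act_flag h a).
Proof.
congr (_, _); apply/ffunP=> i; rewrite !ffunE /=.
  rewrite -limg_comp; congr (lfun_img _ _); apply/lfunP=> x.
  by rewrite !lfunE /= !lfunE /= mulmxA.
rewrite -map_comp; apply: eq_map => C /=; rewrite -imset_comp.
by apply: eq_imset => x /=; rewrite mulmxA.
Qed.

Lemma act_vcoset g U v :
  [set g *m x | x in vcoset U v] = vcoset (linfun (mulmx g) @: U)%VS (g *m v).
Proof.
apply/setP=> y; rewrite inE; apply/imsetP/memv_imgP=> [[x]|[u uU yE]].
  by rewrite inE => xU ->; exists (x - v); rewrite // lfunE /= mulmxBr.
exists (v + u); first by rewrite inE addrC addKr.
by rewrite mulmxDr -[g *m u](lfunE (mulmx g)) -yE addrC subrK.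
Qed.

(** Independence modulo [U] makes the representatives free and their span disjoint from [U], so
    dimensions add. *)
Lemma quotient_basis_span W U B : (U <= W)%VS -> quotient_basis W U B ->
  exists v : seq 'cV[F]_n,
    [/\ size v = (\dim W - \dim U)%N, W = (U + <<v>>)%VS
      & B = [seq vcoset U x | x <- v]].
Proof.
move=> UW [v [vW -> v_indep v_gen]]; exists v.
have WE : W = (U + <<v>>)%VS.
  apply/eqP; rewrite eqEsubv subv_add UW /=; apply/andP; split; last exact/span_subvP.
  apply/subvP=> w /v_gen [c wU]; rewrite -[w](subrK (\sum_i c i *: v`_i)).
  apply: memv_add => //; apply: memv_suml => i _.
  by apply: memvZ; apply/memv_span/mem_nth.
have v_free : free v.
  rewrite -[v]in_tupleE; apply/freeP=> c c0 i; apply: (v_indep c _ i).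
  by move: c0 => /= ->; apply: mem0v.
split=> //; rewrite [in RHS]WE dimv_disjoint_sum; first by rewrite addKn (eqP v_free).
apply/eqP; rewrite -subv0; apply/subvP=> w; rewrite memv_cap => /andP[wU].
rewrite -[v]in_tupleE => /coord_span wE.
have c0 := v_indep (fun i => coord (in_tuple v) i w) _.
rewrite wE big1 ?mem0v // => i _; rewrite c0 ?scale0r //.
by move: wU; rewrite {1}wE.
Qed.

(** A basis of the whole space adapted to the flag is built step by step: representatives of the
    given quotient basis at marked steps, a basis of any complement at the others. *)
Lemma flag_basis alpha (a : preflag F n alpha) : is_flag a ->
  exists v : 'I_(size (rho alpha)) -> seq 'cV[F]_n,
    [/\ forall i, size (v i) = part i,
        forall m, a.1 m = <<flatten (take m [seq v i | i <- enum 'I__])>>%VS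
      & forall i, a.2 i = [seq vcoset (a.1 (before (val i))) x | x <- v (val i)]].
Proof.
case: a => V B [V0 _ Vle Vdim BP] /=.
have step i : exists vi : seq 'cV[F]_n,
    [/\ size vi = part i, V (after i) = (V (before i) + <<vi>>)%VS
      & forall mi : i \in marks alpha,
          B (exist _ i mi) = [seq vcoset (V (before i)) x | x <- vi]].
  have /orP [mi|/negPf mi] := orbN (i \in marks alpha).
    have [vi [sz_vi VE BE]] := quotient_basis_span (Vle i) (BP (exist _ i mi)).
    exists vi; split=> [||mi']; rewrite ?sz_vi // -BE.
    by congr (B _); apply: val_inj.
  exists (vbasis (V (after i) :\: V (before i))); split=> [||mi']; last by have := mi'; rewrite mi.
    by rewrite size_tuple -Vdim -[in RHS](dimv_cap_compl _ (V (before i))) (capv_idPr (Vle i)) addKn.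
  by rewrite (span_basis (vbasisP _)) addvC addv_diff (addv_idPl (Vle i)).
have [v vP] := fin_all_exists step; exists v; split=> [i|m|[i mi]].
- by case: (vP i).
- case: m => m /=; elim: m => [|m IHm] lem.
    by rewrite take0 span_nil -V0; congr (V _); apply: val_inj.
  have ltm : (m < size (rho alpha))%N by [].
  pose i := Ordinal ltm.
  have -> : V (Ordinal lem) = V (after i).
    by congr (V _); apply: val_inj; rewrite /= /bump add1n.
  have [_ -> _] := vP i.
  have -> : before i = Ordinal (ltnW lem) by apply: val_inj.
  have sz_v : size [seq v i | i <- enum 'I__] = size (rho alpha).
    by rewrite size_map size_enum_ord.
  rewrite /= (take_nth [::]) ?sz_v // flatten_rcons span_cat -(IHm (ltnW lem)).
  by rewrite (nth_map i) ?size_enum_ord // (nth_ord_enum i i).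
- by case: (vP i) => _ _; apply.
Qed.

Lemma dim_cV : \dim (fullv : {vspace 'cV[F]_n}) = n.
Proof. by rewrite dimvf dim_matrix; apply: muln1. Qed.

Lemma linear_mx (f : {linear 'cV[F]_n -> 'cV[F]_n}) :
  exists g : 'M[F]_n, forall x, g *m x = f x.
Proof.
exists (\matrix_(i, j) f (delta_mx j 0) i 0) => x.
have xE : x = \sum_j x j 0 *: delta_mx j 0.
  by rewrite {1}[x]matrix_sum_delta; apply: eq_bigr => j _; rewrite big_ord1.
rewrite {2}xE linear_sum; apply/colP=> i; rewrite mxE summxE.
by apply: eq_bigr => j _; rewrite linearZ !mxE mulrC.
Qed.

(** Matrices sending X to Y and Y to X compose to a map fixing the spanning list X, hence to the
    identity. *)
Lemma unitmx_of_bases (X Y : seq 'cV[F]_n) :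
    size X = n -> size Y = n -> <<X>>%VS = fullv -> <<Y>>%VS = fullv ->
  exists2 g : 'M[F]_n, g \in unitmx & [seq g *m x | x <- X] = Y.
Proof.
have map_basis (S T : seq 'cV[F]_n) : size S = n -> size T = n ->
    <<S>>%VS = fullv -> exists g : 'M[F]_n, [seq g *m x | x <- S] = T.
  move=> szS szT spanS; have [f fP] := linear_of_free S T.
  have [g gE] := linear_mx f; exists g; rewrite (eq_map gE).
  by rewrite fP ?szS // /free spanS dim_cV szS.
move=> szX szY spanX spanY.
have [g gX] := map_basis X Y szX szY spanX.
have [h hY] := map_basis Y X szY szX spanY.
exists g => //; apply: (@proj2 (h \in unitmx)); apply: mulmx1_unit.
have hgX : {in X, linfun (mulmx (h *m g)) =1 linfun (mulmx (1%:M : 'M[F]_n))}.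
  move=> x /(nthP 0) [i ltiX <-]; rewrite !lfunE /= mul1mx -mulmxA.
  have -> : g *m X`_i = Y`_i by rewrite -gX (nth_map 0).
  by rewrite -hY (nth_map 0) // szY -szX.
apply/matrixP=> i j.
have /span_lfunP/(_ (delta_mx j 0)) := hgX.
rewrite spanX memvf !lfunE /= -!colE => /(_ isT) /colP/(_ i).
by rewrite !mxE.
Qed.

(** An adapted basis of [a] is carried to an adapted basis of [b]. *)
Lemma GL_transitive_flags alpha (a b : preflag F n alpha) :
    sumn (rho alpha) = n -> is_flag a -> is_flag b ->
  exists2 g, g \in unitmx & act_flag g a = b.
Proof.
move=> rho_n flag_a flag_b.
have [v [szv aV aB]] := flag_basis flag_a.
have [w [szw bV bB]] := flag_basis flag_b.
pose cat (u : 'I_(size (rho alpha)) -> seq 'cV[F]_n) := flatten [seq u i | i <- enum 'I__].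
have shape_cat (u : 'I_(size (rho alpha)) -> seq 'cV[F]_n) : (forall i, size (u i) = part i) ->
    shape [seq u i | i <- enum 'I__] = rho alpha.
  move=> szu; rewrite /shape -map_comp; apply: (@eq_from_nth _ 0%N).
    by rewrite size_map size_enum_ord.
  move=> i; rewrite size_map size_enum_ord => lti.
  by rewrite (nth_map (Ordinal lti)) ?size_enum_ord //= szu /part nth_enum_ord.
have size_cat u : (forall i, size (u i) = part i) -> size (cat u) = n.
  by move=> szu; rewrite size_flatten shape_cat.
have span_cat (c : preflag F n alpha) u : is_flag c ->
    (forall m, c.1 m = <<flatten (take m [seq u i | i <- enum 'I__])>>%VS) ->
    <<cat u>>%VS = fullv.
  case: c => V B [_ <- _ _ _] -> /=.
  by rewrite take_oversize // size_map size_enum_ord.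
have [g g_unit gvw] := unitmx_of_bases (size_cat v szv) (size_cat w szw)
  (span_cat _ _ flag_a aV) (span_cat _ _ flag_b bV).
exists g => //.
(* Both concatenations have shape [rho alpha], so their equality splits into blocks. *)
have gvw' : [seq [seq g *m x | x <- u] | u <- [seq v i | i <- enum 'I__]] =
            [seq w i | i <- enum 'I__].
  apply: eq_from_flatten_shape; first by rewrite -map_flatten; exact: gvw.
  rewrite (shape_cat w szw) -map_comp shape_cat // => i.
  by rewrite size_map.
have gV m : (linfun (mulmx g) @: a.1 m)%VS = b.1 m.
  rewrite aV bV limg_span map_flatten map_take -gvw'; congr <<flatten (take _ _)>>%VS.
  by do 2!apply: eq_map => ?; rewrite lfunE.
have gvi i : [seq g *m x | x <- v i] = w i.
  move: gvw'; rewrite -map_comp => /eq_in_map/(_ i).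
  by rewrite mem_enum; apply.
rewrite [b]surjective_pairing; congr (_, _); apply/ffunP=> i; rewrite !ffunE //.
rewrite aB bB -gvi -!map_comp; apply: eq_map => x /=.
by rewrite act_vcoset gV.
Qed.

End FlagTransitivity.

(** * Counting group elements between flags *)

(** The hypothesis is an inequality because a translation supplies an injection of one fibre into
    another; by symmetry all fibres have equal size. *)
Lemma card_fibers (T C : finType) (S : {set T}) (c : T -> C) :
    (forall x y, #|[set g in S | c g == x]| <= #|[set g in S | c g == y]|)%N ->
  forall x, (#|[set g in S | c g == x]| * #|C|)%N = #|S|.
Proof.
move=> le_fib x; rewrite -[RHS]sum1_card (partition_big c xpredT) //= mulnC.
rewrite -sum_nat_const; apply: eq_bigr => y _; rewrite sum1dep_card.
by apply/eqP; rewrite eqn_leq !le_fib.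
Qed.

Section StabilizerCounting.
Variables (F : finFieldType) (n : nat) (alpha : marked_seq).
Implicit Types (g h : 'M[F]_n) (a b : preflag F n alpha).

Lemma flag_mono a : is_flag a ->
  forall i j : 'I_(size (rho alpha)).+1, (i <= j)%N -> (a.1 i <= a.1 j)%VS.
Proof.
case: a => V B [_ _ Vle _ _] /= i [j]; elim: j => [|j IHj] ltj leij.
  have -> : i = Ordinal ltj by apply/val_inj/eqP; rewrite -leqn0.
  exact: subvv.
have [->|leij'] : i = Ordinal ltj \/ (i <= j)%N.
- by move: leij; rewrite leq_eqVlt => /orP[/eqP ij|]; [left; apply: val_inj | right].
- exact: subvv.
have ltj' : (j < size (rho alpha))%N by [].
apply: subv_trans (IHj (ltnW ltj) leij') _.
have := Vle (Ordinal ltj').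
have -> : before (Ordinal ltj') = Ordinal (ltnW ltj) by apply: val_inj.
have -> // : after (Ordinal ltj') = Ordinal ltj.
by apply: val_inj; rewrite /= /bump add1n.
Qed.

(** The last step is unmarked, so all proper subspaces and all basis representatives lie in the
    space before it, where [h] is the identity; the full space is preserved since [h] is
    invertible. *)
Lemma act_flag_fix a h (k : 'I_(size (rho alpha))) : is_flag a ->
    k.+1 = size (rho alpha) -> k \notin marks alpha -> h \in unitmx ->
    (forall u, u \in a.1 (before k) -> h *m u = u) -> act_flag h a = a.
Proof.
move=> flag_a kS k_unmarked h_unit h_fix; have mono := flag_mono flag_a.
have img_fix (i : 'I_(size (rho alpha)).+1) : (linfun (mulmx h) @: a.1 i)%VS = a.1 i.
  have [leik|ltki] := leqP i k.
    rewrite -[RHS]lim1g; apply: eq_in_limg => u ui; rewrite !lfunE /=.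
    by apply: h_fix; move/subvP: (mono i (before k) leik); apply.
  have -> : i = ord_max.
    apply/val_inj/anti_leq/andP; split; first exact: leq_ord.
    by apply: leq_trans ltki; rewrite kS.
  case: a flag_a {mono h_fix} => V B [_ -> _ _ _] /=.
  apply/eqP; rewrite eqEsubv subvf; apply/subvP=> x _.
  by rewrite -(mulKVmx h_unit x) -[h *m _](lfunE (mulmx h)) memv_img ?memvf.
rewrite [RHS]surjective_pairing; congr (_, _); apply/ffunP=> i; rewrite ffunE //.
have ltik : (val i < k)%N.
  rewrite ltn_neqAle -ltnS kS ltn_ord andbT.
  by apply: contraNneq k_unmarked => ik; rewrite -(val_inj ik) (valP i).
have leik : (after (val i) <= before k)%N by rewrite /= /bump add1n.
case: a flag_a {mono} h_fix img_fix (mono _ _ leik) => V B [_ _ Vle _ BP] /= h_fix img_fix Vleik.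
case: (BP i) => v [vV -> _ _]; rewrite -map_comp; apply/eq_in_map => x xv /=.
rewrite act_vcoset img_fix h_fix //.
by move/subvP: Vleik; apply; apply: vV.
Qed.

(** If g1 takes a2 to a1 and g2 takes b1 to b2, then g -> g2 g g1 injects one set into the other. *)
Lemma card_GL_flags a b a' b' : sumn (rho alpha) = n ->
    is_flag a -> is_flag b -> is_flag a' -> is_flag b' ->
  #|[set g in GL F n | act_flag g a == b]| =
  #|[set g in GL F n | act_flag g a' == b']|.
Proof.
move=> rho_n.
suff le_card (a1 b1 a2 b2 : preflag F n alpha) :
    is_flag a1 -> is_flag b1 -> is_flag a2 -> is_flag b2 ->
    (#|[set g in GL F n | act_flag g a1 == b1]| <=
     #|[set g in GL F n | act_flag g a2 == b2]|)%N.
  by move=> *; apply/eqP; rewrite eqn_leq !le_card.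
move=> fa1 fb1 fa2 fb2.
have [g1 g1_unit g1E] := GL_transitive_flags rho_n fa2 fa1.
have [g2 g2_unit g2E] := GL_transitive_flags rho_n fb1 fb2.
have mul_inj : injective (fun g => g2 *m g *m g1).
  by move=> g g' /(can_inj (mulmxK g1_unit))/(can_inj (mulKmx g2_unit)).
rewrite -(card_imset _ mul_inj).
apply/subset_leq_card/subsetP=> _ /imsetP[g + ->].
rewrite !inE !unitmx_mul g1_unit g2_unit andbT => /andP[-> /eqP gE].
by rewrite !act_flag_mul g1E gE g2E eqxx.
Qed.

End StabilizerCounting.

(** * Compositions with the marked parts first *)

Section ConcatenatedType.
Variables s1 s2 : seq nat.

Definition cat_marked : marked_seq :=
  @MarkedSeq (s1 ++ s2) [set i : 'I_(size (s1 ++ s2)) | (i < size s1)%N].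

(** Passing from ordinals to [iota] lets initial and final segments of positions be cut out
    directly. *)
Let parts_filter (A : {set 'I_(size (s1 ++ s2))}) (a : pred nat) :
    (forall i : 'I_(size (s1 ++ s2)), (i \in A) = a i) ->
  [seq part (alpha := cat_marked) i | i in A] =
  [seq nth 0%N (s1 ++ s2) j | j <- iota 0 (size (s1 ++ s2)) & a j].
Proof.
move=> Aa; rewrite -val_enum_ord filter_map -map_comp enumT.
by congr map; apply: eq_filter => i; apply: Aa.
Qed.

Lemma type_of_cat_marked : type_of cat_marked = (sort geq s1, sort geq s2).
Proof.
rewrite /type_of /=; congr (sort _ _, sort _ _).
  rewrite (parts_filter (a := fun j => (j < size s1)%N)) => [|i]; last by rewrite inE.
  rewrite size_cat -{1}(add0n (size s1)) filter_iota_ltn ?leq_addr //.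
  by rewrite map_nth_iota0 ?size_cat ?leq_addr // take_size_cat.
rewrite (parts_filter (a := fun j => (size s1 <= j)%N)) => [|i]; last by rewrite in_setC inE -leqNgt.
rewrite size_cat iotaD filter_cat add0n.
rewrite (eq_in_filter (a2 := pred0)) => [|j]; last first.
  by rewrite mem_iota add0n ltnNge => /negbTE.
rewrite filter_pred0 (eq_in_filter (a2 := predT)) => [|j]; last by rewrite mem_iota => /andP[->].
rewrite filter_predT map_nth_iota ?size_cat ?addKn //.
by rewrite drop_size_cat // take_size.
Qed.

End ConcatenatedType.

(** * Sparse transitive sets *)

Lemma sumn_ge_mem (s : seq nat) x : x \in s -> (x <= sumn s)%N.
Proof.
elim: s => //= y s IHs; rewrite inE => /orP[/eqP->|/IHs le_x]; first exact: leq_addr.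
exact: leq_trans le_x (leq_addl _ _).
Qed.

Theorem corollary6p6 (R : realType) (F : finFieldType) (t : nat)
    (sigma tau' : seq nat) (hTheta : in_Theta t #|F| sigma tau')
    (eps : R) (heps : 0 < eps) :
  exists N : nat, forall n : nat, (N <= n)%N ->
    exists Y : {set 'M[F]_n},
      [/\ Y \subset GL F n,
          Y != set0,
          transitive_set sigma ((n - sumn sigma - sumn tau')%N :: tau') Y
        & #|Y|%:R / #|GL F n|%:R < eps].
Proof.
case/and4P: hTheta => /andP[sigma_sorted sigma_pos] /andP[tau_sorted tau_pos].
move=> /eqP sum_t tau_gt1.
(* Then eps^-1 < s < q^s, so the density q^-s is below [eps]. *)
pose s := Num.bound eps^-1.
pose J : finType := ('I_s * 'I_t.+1 + 'I_s * 'I_t.+1)%type.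
(* The first bound makes room for the indices p and d. The second gives n - t >= t, so that this
   part comes first in tau, and n - t > 1, as required when q = 2. *)
exists (maxn #|J| (t + t + 2))%N => n; rewrite geq_max => /andP[leJn let_n].
pose e (u : J) : 'I_n := widen_ord leJn (enum_rank u).
have e_inj : injective e.
  by move=> u u' /(congr1 val) /= /val_inj /enum_rank_inj.
pose clr := @color F n s t e.
pose Y : {set 'M[F]_n} := [set g in GL F n | clr g == 0].
have card_C : #|'rV[F]_s| = (#|F| ^ s)%N by rewrite card_mx mul1n.
(* Colour 0 takes the share q^-s of any set of invertible matrices stable under right multiplication
   by the pointwise stabilizer of [U]. This is used for all of GL and for the solutions of g a =
   b. *)
have fib (P : pred 'M[F]_n) (U : {vspace 'cV[F]_n}) : (\dim U <= t)%N ->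
    (forall g h, h \in unitmx -> (forall u, u \in U -> h *m u = u) ->
       P g -> P (g *m h)) ->
    (#|[set g in Y | P g]| * #|F| ^ s)%N = #|[set g in GL F n | P g]|.
  move=> dimU P_h; rewrite -card_C.
  rewrite -(@card_fibers _ _ [set g in GL F n | P g] clr _ 0) => [|x y].
    by congr (_ * _)%N; apply: eq_card => g; rewrite !inE andbAC.
  (* Right multiplication by [h] injects the fibre over x into the fibre over y. *)
  have [h [h_unit h_fix h_clr]] := color_translation e_inj (y - x) dimU.
  rewrite -(card_imset _ (can_inj (mulmxK h_unit))).
  apply/subset_leq_card/subsetP=> _ /imsetP[g + ->].
  rewrite !inE unitmx_mul h_unit andbT => /andP[/andP[g_unit Pg] /eqP gx].
  by rewrite g_unit P_h //= /clr h_clr // -/clr gx addrC subrK.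
have cardY : (#|Y| * #|F| ^ s)%N = #|GL F n|.
  have := fib xpredT 0%VS; rewrite dimv0 => /(_ isT (fun _ _ _ _ _ => isT)).
  have setT_id (S : {set 'M[F]_n}) : [set g in S | true] = S.
    by apply/setP=> g; rewrite inE andbT.
  by rewrite !setT_id.
have GL_gt0 : (0 < #|GL F n|)%N.
  by apply/card_gt0P; exists 1%:M; rewrite inE unitmx1.
have F_gt1 : (1 < #|F|)%N := card_finNzRing_gt1 F.
have Y_gt0 : (0 < #|Y|)%N by move: GL_gt0; rewrite -cardY muln_gt0 => /andP[].
exists Y; split.
- by apply/subsetP=> g; rewrite inE => /andP[].
- by rewrite -card_gt0.
- have subn_t : (n - sumn sigma - sumn tau')%N = (n - t)%N by rewrite -subnDA sum_t.
  rewrite subn_t.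
  have le_tn : (t <= n)%N by rewrite (leq_trans _ let_n) // -addnA leq_addr.
  have let' : (t <= n - t)%N.
    by rewrite leq_subRL // (leq_trans _ let_n) // leq_addr.
  have lt_1 : (1 < n - t)%N.
    by rewrite ltn_subRL -addnS (leq_trans _ let_n) // -addnA leq_add2l leq_addl.
  (* The large part is placed last in the composition, so that the proper part of a flag has
     dimension at most t; sorting moves it to the front of tau. *)
  pose s2 := tau' ++ [:: (n - t)%N].
  pose alpha := cat_marked sigma s2.
  have rho_n : sumn (rho alpha) = n.
    by rewrite /= !sumn_cat /= addn0 addnA sum_t subnKC.
  have s2E : sort geq s2 = (n - t)%N :: tau'.
    have geq_anti : antisymmetric geq by move=> x y; rewrite andbC => /anti_leq.
    have geq_trans : transitive geq by move=> y x z /= yx zy; apply: leq_trans zy yx.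
    have geq_total : total geq by move=> x y; apply: leq_total.
    rewrite -[RHS](sorted_sort geq_trans).
      by apply/perm_sortP => //; rewrite /s2 cats1 perm_rcons.
    rewrite /= path_min_sorted //; apply/allP=> x /sumn_ge_mem le_x /=.
    by rewrite (leq_trans le_x) // (leq_trans _ let') // -sum_t leq_addl.
  exists alpha.
    split; last first.
      rewrite type_of_cat_marked s2E sorted_sort //.
      by move=> y x z /= yx zy; apply: leq_trans zy yx.
    apply/and3P; split; last first.
    + apply/implyP=> /(implyP tau_gt1) tau_gt1'.
      apply/forallP=> i; apply/implyP; rewrite inE -leqNgt => le_i.
      rewrite /part /= nth_cat [(i < _)%N]ltnNge le_i /=.
      have s2_gt1 : all (fun k => (1 < k)%N) s2 by rewrite all_cat tau_gt1' /= lt_1.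
      apply: (all_nthP 0%N s2_gt1).
      by rewrite ltn_subLR // -size_cat ltn_ord.
    + exact/eqP.
    + by rewrite /= !all_cat sigma_pos tau_pos /= (ltnW lt_1).
  have ltk : (size sigma + size tau' < size (rho alpha))%N.
    by rewrite /= !size_cat /= addn1 addnS.
  pose k := Ordinal ltk.
  have kS : k.+1 = size (rho alpha) by rewrite /= !size_cat /= addn1 addnS.
  have k_unmarked : k \notin marks alpha by rewrite inE -leqNgt leq_addr.
  have part_k : part k = (n - t)%N.
    by rewrite /part /= nth_cat ltnNge leq_addr /= addKn nth_cat ltnn subnn.
  have dim_k (a : preflag F n alpha) : is_flag a -> (\dim (a.1 (before k)) <= t)%N.
    case: a => V B [_ Vmax _ Vdim _] /=.
    have := Vdim k; rewrite part_k.
    have -> : after k = ord_max.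
      by apply: val_inj; rewrite /= /bump add1n -[RHS]kS.
    rewrite Vmax dim_cV => dimE.
    have : (\dim (V (before k)) <= n)%N by rewrite -[X in (_ <= X)%N](dim_cV F n) dimvS ?subvf.
    by move=> le_n; rewrite -(leq_sub2lE _ le_n) dimE.
  have cardYab (a b : preflag F n alpha) : is_flag a ->
      (#|[set g in Y | act_flag g a == b]| * #|F| ^ s)%N =
      #|[set g in GL F n | act_flag g a == b]|.
    move=> flag_a; apply: (fib _ _ (dim_k a flag_a)) => g h h_unit h_fix.
    by rewrite act_flag_mul (act_flag_fix flag_a kS k_unmarked h_unit h_fix).
  (* The constant r is read off at one flag; if there were none, any r would do. *)
  have [[a0 flag_a0]|no_flag] := pselect (exists a : preflag F n alpha, is_flag a); last first.
    by exists 0%N => a b flag_a; case: no_flag; exists a.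
  exists #|[set g in Y | act_flag g a0 == a0]| => a b flag_a flag_b.
  have Fs_gt0 : (0 < #|F| ^ s)%N by rewrite expn_gt0 ltnW.
  (* After multiplication by q^s both counts become counts in GL, which do not depend on the
     flags. *)
  apply/eqP; rewrite -(eqn_pmul2r Fs_gt0) !cardYab //; apply/eqP.
  exact: card_GL_flags.
rewrite -cardY natrM invfM mulrA mulfV ?mul1r ?pnatr_eq0 -?lt0n //.
rewrite invf_plt ?posrE ?ltr0n ?expn_gt0 ?(ltnW F_gt1) //.
apply: lt_trans (archi_boundP _) _; first by rewrite invr_ge0 ltW.
by rewrite ltr_nat ltn_expl.
Qed.
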